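(* Let $C$ be a non-degenerate conic of $AG(2,\mathbb{F}_q)$ with equation $$a_{11}X^2+a_{12}XY+a_{22}Y^2+a_{13}X+a_{23}Y+a_{33}=0,$$ with coefficients in $\mathbb{F}_q$. Assume that $a_{12}=a_{22}=0$, $a_{23}\neq 0$, and let $a_{23}=1$. Then $$|\bar{\Delta}\cap C|=\begin{cases} \tfrac12 q-1, & \text{if } \mathfrak{Tr}(a_{11})=0,\ a_{33}\ne 0 \text{ and } a_{33}\ne a_{13}^2;\\ \tfrac12 q, & \text{if } \mathfrak{Tr}(a_{11})=1,\ a_{33}\ne 0 \text{ and } a_{33}\ne a_{13}^2;\\ \tfrac12 q, & \text{if } \mathfrak{Tr}(a_{11})=a_{33}=0 \text{ and } a_{33}\ne a_{13}^2;\\ \tfrac12 q+1, & \text{if } \mathfrak{Tr}(a_{11})=1,\ a_{33}=0 \text{ and } a_{33}\ne a_{13}^2;\\ q, & \text{if } \mathfrak{Tr}(a_{11})=0 \text{ and } a_{33}=a_{13}=0;\\ 1, & \text{if } \mathfrak{Tr}(a_{11})=1 \text{ and } a_{33}=a_{13}=0;\\ q-1, & \text{if } \mathfrak{Tr}(a_{11})=0,\ a_{33}=a_{13}^2 \text{ and } a_{33}\ne 0;\\ 0, & \text{if } \mathfrak{Tr}(a_{11})=1,\ a_{33}=a_{13}^2 \text{ and } a_{33}\ne 0. \end{cases}$$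
   Context: Let $q=2^h\ge 4$ be a power of $2$ and let $\mathfrak{Tr}(x)=x+x^2+x^4+\dots+x^{2^{h-1}}$ be the trace of $x\in\mathbb{F}_q$. Let $\bar{\Delta}=\{(x,ax^2): x\in\mathbb{F}_q,\ a\in\mathbb{F}_q,\ \mathfrak{Tr}(a)=0\}\subseteq AG(2,\mathbb{F}_q)$. The conic $C$ is identified with its set of points in $AG(2,\mathbb{F}_q)$; it is degenerate if and only if $a_{11}a_{23}^2+a_{12}a_{23}a_{13}+a_{22}a_{13}^2+a_{33}a_{12}^2=0$, and non-degenerate otherwise. *)

(* Defs.v *)
From mathcomp Require Import all_boot all_order all_algebra.

Set Implicit Arguments.
Unset Strict Implicit.
Unset Printing Implicit Defensive.

Import GRing.Theory.
Local Open Scope ring_scope.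

(* For #|F| = 2 ^ h this is the absolute trace; it is kept F-valued, so its    *)
(* values are the elements 0 and 1 of the prime subfield of F.                *)
Definition Tr (F : finFieldType) (h : nat) (x : F) : F :=
  \sum_(i < h) x ^+ (2 ^ i).

Definition Delta_bar (F : finFieldType) (h : nat) : {set F * F} :=
  [set (x, a * x ^+ 2) | x in F, a in F & Tr h a == 0].

Definition conic (F : finFieldType) (a11 a12 a22 a13 a23 a33 : F) :
    {set F * F} :=
  [set P : F * F | a11 * P.1 ^+ 2 + a12 * P.1 * P.2 + a22 * P.2 ^+ 2
                   + a13 * P.1 + a23 * P.2 + a33 == 0].

(* The discriminant in characteristic 2. It vanishes when                     *)
(* a11 = a12 = a22 = 0, so non-degeneracy forces the equation to be quadratic.*)
Definition degenerate_conic (F : finFieldType) (a11 a12 a22 a13 a23 a33 : F) :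
    bool :=
  a11 * a23 ^+ 2 + a12 * a23 * a13 + a22 * a13 ^+ 2 + a33 * a12 ^+ 2 == 0.

(* Main.v *)
Require Import Defs.
From mathcomp Require Import all_boot all_order all_algebra all_field.

Set Implicit Arguments.
Unset Strict Implicit.
Unset Printing Implicit Defensive.

Import GRing.Theory.
Local Open Scope ring_scope.

(** A conic with [a12 = a22 = 0] and [a23 = 1] is the graph of
    [y = a11 x^2 + a13 x + a33], so the intersection with [Delta_bar] is counted
    by the abscissas [x] of its points ([card_Delta_bar_parabola]).  The abscissa
    [0] gives the point [(0, a33)], which lies in [Delta_bar] iff [a33 = 0].  For
    [x != 0] the point lies in [Delta_bar] iff [y / x^2] has trace [0].  Since
    the trace is additive and invariant under squaring,
      [Tr (y / x^2) = Tr a11 + Tr (a13 / x) + Tr (a33 / x^2)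
                    = Tr a11 + Tr ((a13^2 + a33) / x^2)],
    and the condition becomes [Tr (b / x^2) = Tr a11] with [b = a13^2 + a33]
    ([Tr_parabola]).

    If [b = 0], that is [a33 = a13^2], the condition no longer depends on [x] and
    holds for all [q - 1] or for none of the nonzero [x].  If [b != 0], the map
    [x |-> b / x^2] permutes the nonzero elements, squaring being injective in
    characteristic 2, so what is counted are the nonzero elements of trace
    [Tr a11].  Each of the values 0 and 1 is taken by the trace exactly [q / 2]
    times ([card_Tr_fiber]), and [0] itself has trace [0]. *)

Section Trace.

Variables (F : finFieldType) (h : nat).
Hypothesis cardF : #|F| = (2 ^ h)%N.

Lemma pchar2_card : 2%N \in [pchar F].
Proof. exact: card_finPcharP cardF _. Qed.

Let char2 := pchar2_card.

Lemma TrD (x y : F) : Tr h (x + y) = Tr h x + Tr h y.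
Proof.
rewrite /Tr -big_split; apply: eq_bigr => i _ /=.
by rewrite exprDn_pchar // pnatX (pnatE _ (isT : prime 2)) char2.
Qed.

Lemma Tr0 : Tr h (0 : F) = 0.
Proof. by rewrite /Tr big1 // => i _; rewrite expr0n expn_eq0. Qed.

(** The trace is the sum of the orbit of [x] under the Frobenius map, which
    squaring only permutes because [x ^+ (2 ^ h) = x]. *)
Lemma Tr_sqr (x : F) : Tr h (x ^+ 2) = Tr h x.
Proof.
have xE : x ^+ (2 ^ h) = x by rewrite -cardF expf_card.
have := @big_ord_recl F 0 +%R h (fun i : 'I_h.+1 => x ^+ (2 ^ i)).
rewrite big_ord_recr /= xE expr1 addrC /Tr => /addrI ->.
by apply: eq_bigr => i _; rewrite -exprM -expnS.
Qed.

(** Squaring is additive, hence [Tr x ^+ 2 = Tr (x ^+ 2) = Tr x]. *)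
Lemma Tr_01 (x : F) : (Tr h x == 0) || (Tr h x == 1).
Proof.
have idem : Tr h x ^+ 2 = Tr h x.
  rewrite -[RHS]Tr_sqr /Tr -(pFrobenius_autE char2) rmorph_sum.
  by apply: eq_bigr => i _ /=; rewrite pFrobenius_autE exprAC.
by rewrite -[_ == 1]subr_eq0 -mulf_eq0 mulrBr mulr1 -expr2 idem subrr.
Qed.

(** The elements of trace [c] are roots of [X + X^2 + ... + X^(2^(h-1)) - c],
    whose degree is half the order of the field. *)
Lemma leq_card_Tr_fiber (c : F) :
  (0 < h)%N -> (#|[set x | Tr h x == c]| <= 2 ^ h.-1)%N.
Proof.
case: h => // k _ /=.
pose p : {poly F} := \sum_(i < k.+1) 'X^(2 ^ i) - c%:P.
have lead_p : p`_(2 ^ k) = 1.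
  rewrite coefB coefC expn_eq0 /= subr0 coef_sum big_ord_recr /= coefXn eqxx.
  rewrite big1 ?add0r // => i _; rewrite coefXn eqn_exp2l //.
  by rewrite gtn_eqF.
have p_neq0 : p != 0.
  by apply: contra_eq_neq lead_p => ->; rewrite coef0 eq_sym oner_eq0.
have size_p : (size p <= (2 ^ k).+1)%N.
  rewrite (leq_trans (size_polyD _ _)) // geq_max size_polyN.
  rewrite (leq_trans (size_polyC_leq1 _)) // andbT.
  apply: (leq_trans (size_sum _ _ _)); apply/bigmax_leqP => i _.
  by rewrite size_polyXn ltnS leq_exp2l // -ltnS.
rewrite cardE -ltnS (leq_trans _ size_p) // max_poly_roots ?enum_uniq //.
apply/allP=> x; rewrite mem_enum inE /Tr => /eqP Trx.
rewrite /root hornerD hornerN hornerC horner_sum -Trx subr_eq0.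
by apply/eqP/eq_bigr => i _; rewrite hornerXn.
Qed.

(** The two fibres cover the field and neither can exceed half of it, so both
    have exactly that size. *)
Lemma card_Tr_fiber (c : F) :
  (0 < h)%N -> (c == 0) || (c == 1) -> #|[set x | Tr h x == c]| = (2 ^ h.-1)%N.
Proof.
move=> h_gt0 c01.
have fibers : (#|[set x : F | Tr h x == 0%R]| + #|[set x : F | Tr h x == 1%R]|
               = 2 ^ h.-1 + 2 ^ h.-1)%N.
  rewrite addnn -mul2n -expnS prednK // -cardF -(cardsC [set x | Tr h x == 0]).
  congr (_ + #|pred_of_set _|)%N; apply/setP => x; rewrite !inE.
  case/orP: (Tr_01 x) => /eqP ->; rewrite eqxx ?oner_eq0 //.
  by rewrite eq_sym oner_eq0.
have le0 := leq_card_Tr_fiber 0 h_gt0; have le1 := leq_card_Tr_fiber 1 h_gt0.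
by case/orP: c01 => /eqP ->; apply/eqP; rewrite eqn_leq ?le0 ?le1 /=;
   [rewrite -(leq_add2r (2 ^ h.-1)) -fibers leq_add2l
   |rewrite -(leq_add2l (2 ^ h.-1)) -fibers leq_add2r].
Qed.

(** Only the fibre over [0] loses an element, because [Tr 0 = 0]. *)
Lemma card_Tr_fiber_neq0 (c : F) : (0 < h)%N -> (c == 0) || (c == 1) ->
  #|[set x | Tr h x == c] :\ 0| = (2 ^ h.-1 - (c == 0%R))%N.
Proof.
move=> h_gt0 c01; rewrite -(card_Tr_fiber h_gt0 c01) [in RHS](cardsD1 0).
by rewrite inE Tr0 [0 == c]eq_sym addKn.
Qed.

Lemma mem_Delta_bar (x y : F) :
  ((x, y) \in Delta_bar F h) =
  if x == 0 then y == 0 else Tr h (y / x ^+ 2) == 0.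
Proof.
apply/imset2P/idP => [[u a _] | ].
  rewrite !inE /= => Tra [-> ->]; have [-> | u0] := eqVneq u 0.
    by rewrite expr0n mulr0.
  by rewrite mulfK ?expf_neq0.
have [-> /eqP -> | x0 Try] := eqVneq x 0.
  by exists 0 0; rewrite ?inE ?Tr0 ?eqxx // expr0n mulr0.
by exists x (y / x ^+ 2); rewrite ?inE ?divfK ?expf_neq0.
Qed.

(** Since [Tr (b / x) = Tr (b ^+ 2 / x ^+ 2)], all the dependence on [x] goes
    through [x ^- 2]. *)
Lemma Tr_parabola (a b c x : F) : x != 0 ->
  Tr h ((a * x ^+ 2 + b * x + c) / x ^+ 2) =
  Tr h a + Tr h ((b ^+ 2 + c) * x ^- 2).
Proof.
move=> x0; rewrite !mulrDl mulfK ?expf_neq0 // !TrD -addrA; congr (_ + (_ + _)).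
by rewrite -exprVn -exprMn Tr_sqr exprVn expr2 invfM mulrA mulfK.
Qed.

(** In characteristic 2 squaring is the Frobenius map, hence injective. *)
Lemma div_sqr_inj (b : F) : b != 0 -> injective (fun x : F => b * x ^- 2).
Proof.
move=> b0 x y /(mulfI b0) /invr_inj.
by rewrite -!(pFrobenius_autE char2) => /fmorph_inj.
Qed.

(** The abscissa [0] is split off because [Delta_bar] meets the line [x = 0]
    only in the origin, whatever the trace condition says. *)
Lemma card_Delta_bar_parabola (a b c : F) :
  #|Delta_bar F h :&: conic a 0 0 b 1 c| =
  ((c == 0%R) +
   #|[set x | (Tr h ((b ^+ 2 + c) * x ^- 2) == Tr h a)%R] :\ 0%R|)%N.
Proof.
pose g (x : F) := a * x ^+ 2 + b * x + c.
pose S := [set x | (x, g x) \in Delta_bar F h].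
have -> : Delta_bar F h :&: conic a 0 0 b 1 c = [set (x, g x) | x in S].
  apply/setP => -[x y]; apply/setIP/imsetP => [[xyD] | [u]].
    rewrite inE /= !mul0r !addr0 mul1r addrAC addr_eq0 (oppr_pchar2 char2).
    by move/eqP=> yE; exists x; rewrite ?inE /g ?yE // -yE.
  rewrite !inE => uD [-> ->]; split=> //=.
  by rewrite !mul0r !addr0 mul1r addrAC -/(g u) (addrr_pchar2 char2).
rewrite card_imset => [|x y [] //].
rewrite (cardsD1 0) !inE mem_Delta_bar eqxx /g expr0n !mulr0 !add0r.
congr (_ + #|pred_of_set _|)%N; apply/setP => x; rewrite !inE.
have [// | x0] := eqVneq x 0; rewrite mem_Delta_bar (negPf x0) Tr_parabola //.
by rewrite addr_eq0 (oppr_pchar2 char2) eq_sym.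
Qed.

(** Here the coefficient [b ^+ 2 + c] of [x ^- 2] vanishes, so that the nonzero
    abscissas are either all counted or all discarded. *)
Lemma card_Delta_bar_parabola_sqr (a b c : F) : c = b ^+ 2 ->
  #|Delta_bar F h :&: conic a 0 0 b 1 c| =
  ((c == 0%R) + (if Tr h a == 0%R then 2 ^ h - 1 else 0))%N.
Proof.
move=> cE; rewrite card_Delta_bar_parabola -cE (addrr_pchar2 char2).
congr (_ + _)%N; rewrite -cardF; case: ifP => Tra.
  rewrite subn1 -(cardsC1 (0 : F)); congr #|pred_of_set _|.
  by apply/setP => x; rewrite !inE mul0r Tr0 (eqP Tra) eqxx andbT.
apply/eqP; rewrite cards_eq0 -subset0; apply/subsetP => x.
by rewrite !inE mul0r Tr0 [0 == _]eq_sym Tra andbF.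
Qed.

(** The substitution [x |-> (b ^+ 2 + c) * x ^- 2] fixes [0], by the convention
    [0^-1 = 0], and permutes the nonzero elements; it turns the trace condition
    into membership in a fibre of the trace. *)
Lemma card_Delta_bar_parabola_nsqr (a b c : F) : (0 < h)%N -> c != b ^+ 2 ->
  #|Delta_bar F h :&: conic a 0 0 b 1 c| =
  ((c == 0%R) + (2 ^ h.-1 - (Tr h a == 0%R)))%N.
Proof.
move=> h_gt0 c_neq; rewrite card_Delta_bar_parabola.
have b0 : b ^+ 2 + c != 0 by rewrite addrC addr_eq0 (oppr_pchar2 char2).
rewrite -(card_Tr_fiber_neq0 h_gt0 (Tr_01 a)).
rewrite -(card_preimset _ (div_sqr_inj b0)).
congr (_ + #|pred_of_set _|)%N; apply/setP => x; rewrite !inE.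
by rewrite mulf_eq0 (negPf b0) invr_eq0 expf_eq0.
Qed.

End Trace.

Theorem theorem4 (F : finFieldType) (q h : nat)
    (q_def : q = (2 ^ h)%N) (q_ge4 : (4 <= q)%N) (cardF : #|F| = q)
    (a11 a12 a22 a13 a23 a33 : F) (C : {set F * F})
    (C_eq : C = conic a11 a12 a22 a13 a23 a33)
    (C_nondeg : ~~ degenerate_conic a11 a12 a22 a13 a23 a33)
    (a12_0 : a12 = 0) (a22_0 : a22 = 0) (a23_neq0 : a23 != 0)
    (a23_1 : a23 = 1) :
  (Tr h a11 = 0 -> a33 <> 0 -> a33 <> a13 ^+ 2 ->
     #|Delta_bar F h :&: C| = (q %/ 2 - 1)%N) /\
  (Tr h a11 = 1 -> a33 <> 0 -> a33 <> a13 ^+ 2 ->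
     #|Delta_bar F h :&: C| = (q %/ 2)%N) /\
  (Tr h a11 = 0 -> a33 = 0 -> a33 <> a13 ^+ 2 ->
     #|Delta_bar F h :&: C| = (q %/ 2)%N) /\
  (Tr h a11 = 1 -> a33 = 0 -> a33 <> a13 ^+ 2 ->
     #|Delta_bar F h :&: C| = (q %/ 2 + 1)%N) /\
  (Tr h a11 = 0 -> a33 = 0 -> a13 = 0 ->
     #|Delta_bar F h :&: C| = q) /\
  (Tr h a11 = 1 -> a33 = 0 -> a13 = 0 ->
     #|Delta_bar F h :&: C| = 1%N) /\
  (Tr h a11 = 0 -> a33 = a13 ^+ 2 -> a33 <> 0 ->
     #|Delta_bar F h :&: C| = (q - 1)%N) /\
  (Tr h a11 = 1 -> a33 = a13 ^+ 2 -> a33 <> 0 ->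
     #|Delta_bar F h :&: C| = 0%N).
Proof.
have h_gt0 : (0 < h)%N by case: h q_def q_ge4 => // ->.
have {}q_def : #|F| = (2 ^ h)%N by rewrite cardF.
have q2 : (q %/ 2 = 2 ^ h.-1)%N.
  by rewrite -cardF q_def -(prednK h_gt0) expnS mulKn.
rewrite q2 -cardF q_def C_eq a12_0 a22_0 a23_1.
have sqr := card_Delta_bar_parabola_sqr q_def a11.
have nsqr := fun b c => @card_Delta_bar_parabola_nsqr _ _ q_def a11 b c h_gt0.
have one0 : (1 == 0 :> F) = false := oner_eq0 F.
do !split.
- by move=> T0 /eqP/negPf c0 /eqP cb; rewrite nsqr // c0 T0 eqxx.
- by move=> T1 /eqP/negPf c0 /eqP cb; rewrite nsqr // c0 T1 one0 subn0.
- by move=> T0 c0 /eqP cb; rewrite nsqr // c0 T0 eqxx subnKC // expn_gt0.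
- by move=> T1 c0 /eqP cb; rewrite nsqr // c0 T1 eqxx one0 subn0 addnC.
- move=> T0 c0 b0; rewrite sqr; last by rewrite c0 b0 expr0n.
  by rewrite c0 T0 !eqxx subnKC // expn_gt0.
- move=> T1 c0 b0; rewrite sqr; last by rewrite c0 b0 expr0n.
  by rewrite c0 T1 eqxx one0.
- by move=> T0 cb /eqP/negPf c0; rewrite sqr // c0 T0 eqxx.
- by move=> T1 cb /eqP/negPf c0; rewrite sqr // c0 T1 one0.
Qed.
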